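(* The nested Braid fan $\mathrm{Br}_d^2$ is the barycentric subdivision of the Braid fan $\mathrm{Br}_d$, and thus is the second barycentric subdivision of the normal fan $\Sigma(\Delta_d)$ of the standard simplex $\Delta_d=\mathrm{conv}\{\mathbf{e}_1,\dots,\mathbf{e}_{d+1}\}\subset\mathbb{R}^{d+1}$.
   Context: Let $V_d=\{\mathbf{x}\in\mathbb{R}^{d+1}:\sum_i x_i=0\}$ and $W_d=\mathbb{R}^{d+1}/\mathbb{R}\mathbf{1}$ (where $\mathbf{1}$ is the all-one vector), paired by $\langle \mathbf{w},\mathbf{x}\rangle=\sum_i w_ix_i$; all fans here live in $W_d$, and normal fans of polytopes lying in translates of $V_d$ are taken in $W_d$ (the normal cone of a face $F$ of $P$ is $\{\mathbf{w}\in W_d:\langle\mathbf{w},\mathbf{x}\rangle\ge\langle\mathbf{w},\mathbf{y}\rangle\ \forall \mathbf{x}\in F,\mathbf{y}\in P\}$). For $\pi\in\mathfrak{S}_{d+1}$ let $\sigma(\pi)=\{\mathbf{x}\in W_d: x_{\pi^{-1}(1)}\le x_{\pi^{-1}(2)}\le\cdots\le x_{\pi^{-1}(d+1)}\}$; the Braid fan $\mathrm{Br}_d$ is the collection of all $\sigma(\pi)$ together with all their faces. For $\pi\in\mathfrak{S}_{d+1}$ and $\mathbf{x}\in W_d$ put $(\Delta\mathbf{x})^\pi_i=x_{\pi^{-1}(i+1)}-x_{\pi^{-1}(i)}$ for $1\le i\le d$. For $(\pi,\tau)\in\mathfrak{S}_{d+1}\times\mathfrak{S}_d$ let $\sigma(\pi,\tau)$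 be the set of $\mathbf{x}\in W_d$ with $x_{\pi^{-1}(1)}\le\cdots\le x_{\pi^{-1}(d+1)}$ and $(\Delta\mathbf{x})^\pi_{\tau^{-1}(1)}\le(\Delta\mathbf{x})^\pi_{\tau^{-1}(2)}\le\cdots\le(\Delta\mathbf{x})^\pi_{\tau^{-1}(d)}$; the nested Braid fan $\mathrm{Br}_d^2$ is the collection of all $\sigma(\pi,\tau)$ together with all their faces. Barycentric subdivision of a fan $\Sigma$ all of whose cones are pointed (with respect to the lattice $\mathbb{Z}^{d+1}/\mathbb{Z}\mathbf{1}$): for each nonzero cone $\tau\in\Sigma$ let $\rho_\tau$ be the sum of the primitive generators of the rays of $\tau$; the barycentric subdivision of $\Sigma$ is the fan consisting of $\{0\}$ and the cones $\mathrm{cone}(\rho_{\tau_1},\dots,\rho_{\tau_k})$ for all chains $\tau_1\subsetneq\tau_2\subsetneq\cdots\subsetneq\tau_k$ of nonzero cones of $\Sigma$ (equivalently, the fan obtained by successive stellar subdivisions of all cones of $\Sigma$ in order of decreasing dimension). *)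

(* Defs.v *)
From HB Require Import structures.
From mathcomp Require Import all_boot all_order all_fingroup all_algebra.
From mathcomp Require Import boolp classical_sets cardinality fsbigop reals.

Set Implicit Arguments.
Unset Strict Implicit.
Unset Printing Implicit Defensive.
Import Order.TTheory GRing.Theory Num.Theory.
Local Open Scope classical_set_scope.
Local Open Scope ring_scope.
Local Open Scope quotient_scope.

(* MathComp provides the quotient of an additive group by a subgroup; when the
   subgroup is a vector subspace U, the quotient inherits a module structure. *)
Definition quotv (K : fieldType) (vT : vectType K) (U : {vspace vT}) : Type :=
  Quotient.quot (pred_of_vspace U).

Section QuotientSpace.
Variables (K : fieldType) (vT : vectType K) (U : {vspace vT}).

HB.instance Definition _ := GRing.Zmodule.on (quotv U).

Definition proj_quotv (x : vT) : quotv U := \pi_(Quotient.quot U) x.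

Definition scale_quotv (a : K) (w : quotv U) : quotv U :=
  proj_quotv (a *: generic_quotient.repr (w : Quotient.quot U)).

Lemma proj_quotv_eqP (x y : vT) : proj_quotv x = proj_quotv y <-> x - y \in U.
Proof.
rewrite /proj_quotv; split.
  by move=> /eqP; rewrite -Quotient.idealrBE.
by move=> h; apply/eqP; rewrite -Quotient.idealrBE.
Qed.

Lemma proj_quotv_surj (w : quotv U) : exists x, proj_quotv x = w.
Proof. by exists (generic_quotient.repr (w : Quotient.quot U)); rewrite /proj_quotv reprK. Qed.

Lemma proj_quotvD (x y : vT) :
  proj_quotv (x + y) = proj_quotv x + proj_quotv y.
Proof. exact: (@raddfD vT (Quotient.quot U) (\pi_(Quotient.quot U)) x y). Qed.

Lemma proj_quotvZ (a : K) (x : vT) :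
  proj_quotv (a *: x) = scale_quotv a (proj_quotv x).
Proof.
apply/proj_quotv_eqP; rewrite -scalerBr memvZ //.
by apply/proj_quotv_eqP; rewrite /proj_quotv reprK.
Qed.

Lemma scale_quotvA (a b : K) (w : quotv U) :
  scale_quotv a (scale_quotv b w) = scale_quotv (a * b) w.
Proof.
by have [x <-] := proj_quotv_surj w; rewrite -!proj_quotvZ scalerA.
Qed.

Lemma scale_quotv1 : left_id 1 scale_quotv.
Proof.
by move=> w; have [x <-] := proj_quotv_surj w; rewrite -proj_quotvZ scale1r.
Qed.

Lemma scale_quotvDr : right_distributive scale_quotv +%R.
Proof.
move=> a v w; have [x <-] := proj_quotv_surj v; have [y <-] := proj_quotv_surj w.
by rewrite -proj_quotvD -!proj_quotvZ scalerDr proj_quotvD.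
Qed.

Lemma scale_quotvDl (w : quotv U) :
  {morph scale_quotv^~ w : a b / a + b >-> a + b}.
Proof.
move=> a b /=; have [x <-] := proj_quotv_surj w.
by rewrite -!proj_quotvZ scalerDl proj_quotvD.
Qed.

HB.instance Definition _ := GRing.Zmodule_isLmodule.Build K (quotv U)
  scale_quotvA scale_quotv1 scale_quotvDr scale_quotvDl.

Lemma proj_quotv_is_linear : linear proj_quotv.
Proof. by move=> a x y; rewrite proj_quotvD proj_quotvZ. Qed.

HB.instance Definition _ := GRing.isLinear.Build K vT (quotv U) _ proj_quotv
  proj_quotv_is_linear.

End QuotientSpace.

Section ConesAndFaces.
Variables (R : realType) (V : lmodType R).

(* Nonempty faces of a convex set P, with P itself among them (take l = 0,
   b = 0).  If P is a cone then b = 0 is forced, so this is the usual notion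
   of a face of a cone. *)
Definition face (P F : set V) : Prop :=
  F !=set0 /\
  exists (l : {linear V -> R^o}) (b : R),
    (forall x, P x -> l x <= b) /\ F = P `&` [set x | l x = b].

Definition cone n (v : 'I_n -> V) : set V :=
  [set x | exists a : 'I_n -> R,
     (forall i, 0 <= a i) /\ x = \sum_(i < n) a i *: v i].

Definition conv n (v : 'I_n -> V) : set V :=
  [set x | exists a : 'I_n -> R,
     [/\ forall i, 0 <= a i, \sum_(i < n) a i = 1
       & x = \sum_(i < n) a i *: v i]].

Definition ray (v : V) : set V := cone (fun _ : 'I_1 => v).

Variable L : set V.

Definition primitive (v : V) : Prop :=
  [/\ L v, v <> 0 & forall (u : V) (n : nat), L u -> v = u *+ n -> n = 1%N].

Definition ray_generators (C : set V) : set V :=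
  [set v | primitive v /\ face C (ray v)].

(* A finitely supported sum; a pointed polyhedral cone that is rational with
   respect to the lattice L has finitely many rays, each with exactly one
   primitive generator. *)
Definition rho (C : set V) : V := \sum_(v \in ray_generators C) v.

Definition barycentric_subdivision (Sigma : set (set V)) : set (set V) :=
  [set [set 0]] `|`
  [set C | exists (k : nat) (tau : 'I_k.+1 -> set V),
     [/\ forall i, Sigma (tau i) /\ tau i <> [set 0],
         forall i j : 'I_k.+1, (i < j)%N -> tau i `<` tau j
       & C = cone (fun i => rho (tau i))]].

End ConesAndFaces.

Section BraidFans.
Variables (R : realType) (d : nat).

Definition W : Type := quotv <[const_mx 1 : 'rV[R]_d.+1]>%VS.

HB.instance Definition _ := GRing.Lmodule.on W.

Definition toW (x : 'rV[R]_d.+1) : W := proj_quotv _ x.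

Definition latticeW : set W :=
  toW @` [set x : 'rV[R]_d.+1 | forall i, x 0 i \is a Num.int].

Definition dot (w x : 'rV[R]_d.+1) : R := \sum_i w 0 i * x 0 i.

(* For P in a hyperplane \sum_i x_i = c the coordinates of the differences x - y
   below sum to 0, so the condition depends only on the class of w. *)
Definition normal_cone (P F : set 'rV[R]_d.+1) : set W :=
  toW @` [set w : 'rV[R]_d.+1 | forall x y, F x -> P y -> dot w y <= dot w x].

Definition normal_fan (P : set 'rV[R]_d.+1) : set (set W) :=
  [set C | exists F, face P F /\ C = normal_cone P F].

Definition standard_simplex : set 'rV[R]_d.+1 :=
  conv (fun i : 'I_d.+1 => delta_mx 0 i).

(* Indices are 0-based.  The conditions defining the cones below are invariant
   under translation by the all-one vector. *)
Definition braid_cone (p : 'S_d.+1) : set W :=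
  toW @` [set x : 'rV[R]_d.+1 | forall i j : 'I_d.+1, (i <= j)%N ->
                    x 0 (p^-1%g i) <= x 0 (p^-1%g j)].

Definition braid_fan : set (set W) :=
  [set C | exists p, face (braid_cone p) C].

(* As natural numbers, [lift ord0 i] is i + 1 and the widened i is i. *)
Definition Delta (p : 'S_d.+1) (x : 'rV[R]_d.+1) (i : 'I_d) : R :=
  x 0 (p^-1%g (lift ord0 i)) - x 0 (p^-1%g (widen_ord (leqnSn d) i)).

Definition nested_braid_cone (p : 'S_d.+1) (t : 'S_d) : set W :=
  toW @` [set x : 'rV[R]_d.+1 | (forall i j : 'I_d.+1, (i <= j)%N ->
                     x 0 (p^-1%g i) <= x 0 (p^-1%g j)) /\
                  (forall i j : 'I_d, (i <= j)%N ->
                     Delta p x (t^-1%g i) <= Delta p x (t^-1%g j))].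

Definition nested_braid_fan : set (set W) :=
  [set C | exists p t, face (nested_braid_cone p t) C].

End BraidFans.

Arguments latticeW : clear implicits.
Arguments standard_simplex : clear implicits.
Arguments braid_fan : clear implicits.
Arguments nested_braid_fan : clear implicits.

(* Main.v *)
(* The braid fan and the nested braid fan are both of the following kind: vectors
   v_i indexed by a finite set I and a simplicial complex K on I such that the
   cones spanned by the faces of K form a simplicial, unimodular fan.  Then the
   primitive generators of the rays of a cone are the v_i themselves, so the
   barycentric subdivision has generators \sum_(i in A) v_i and complex the
   chains of nonempty faces; it is again simplicial and unimodular, because a
   function on I is in at most one way a nonnegative combination of the
   indicators of a chain of sets (they are its superlevel sets).  The normal fan
   of the simplex comes from v_j = - e_j and the proper subsets of the index set.
   Applying the construction once gives chains of proper nonempty subsets; the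
   maximal ones are the families of lower sets of a permutation p, with the gaps
   Delta p as coordinates, which is the braid fan.  Applying it a second time
   sorts the gaps, which is the nested braid fan. *)
Require Import Defs.
From HB Require Import structures.
From mathcomp Require Import all_boot all_order all_fingroup all_algebra.
From mathcomp Require Import boolp classical_sets reals.
From mathcomp Require Import fsbigop zify ring lra.
(* Again, so that the names shared with [classical_sets] are those of [finset]. *)
From mathcomp Require Import fintype finset.

Set Implicit Arguments.
Unset Strict Implicit.
Unset Printing Implicit Defensive.
Import Order.TTheory GRing.Theory Num.Theory.
Local Open Scope ring_scope.

(** * Chains of subsets of a finite set *)

Section Chains.
Variable I : finType.
Implicit Types (A B C : {set I}) (SS TT : {set {set I}}).

Definition is_chain SS : bool :=
  [forall A in SS, forall B in SS, (A \subset B) || (B \subset A)].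

Lemma is_chainP SS :
  reflect {in SS &, forall A B, (A \subset B) || (B \subset A)} (is_chain SS).
Proof.
apply: (iffP forall_inP) => [h A B hA hB|h A hA].
  exact: (forall_inP (h A hA)).
by apply/forall_inP => B hB; apply: h.
Qed.

Lemma is_chain_sub SS TT : TT \subset SS -> is_chain SS -> is_chain TT.
Proof.
move=> /subsetP h /is_chainP c; apply/is_chainP => A B hA hB.
by apply: c; apply: h.
Qed.

(* The value [None] of [o] plays the role of an extra point lying in no set. *)
Lemma chain_separation SS A : is_chain SS -> A \in SS -> A != set0 ->
  exists2 i, i \in A & exists2 o : option I, ~~ oapp (mem A) false o &
    forall C, C \in SS -> C != A -> (i \in C) = oapp (mem C) false o.
Proof.
move=> /is_chainP c hA A0.
(* Take i in A outside the largest member of [SS] properly contained in A; it then avoids all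
   smaller members too. *)
have [i iA hi] : exists2 i, i \in A &
    forall C, C \in SS -> C \proper A -> i \notin C.
  case: (pickP [pred C | (C \in SS) && (C \proper A)]) => [C0 h0|h0].
    case: (arg_maxnP (fun C : {set I} => #|C|) h0) => C /= /andP[CS CA] mx.
    case/properP: (CA) => _ [i iA iC]; exists i => // D DS DA.
    case/orP: (c _ _ DS CS) => [/subsetP s|s]; first by apply: contra iC; apply: s.
    have := mx D; rewrite DS DA => /(_ isT) le.
    by have /eqP <- : C == D by rewrite eqEcard s.
  case/set0Pn: A0 => i iA; exists i => // C CS CA.
  by have := h0 C; rewrite /= CS CA.
have small C : C \in SS -> C != A -> ~~ (A \proper C) -> C \proper A.
  move=> CS CA AC; rewrite properEneq CA /=.
  case/orP: (c _ _ CS hA) => // s; move: AC.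
  by rewrite properEneq eq_sym CA s.
exists i => //.
(* Dually, o is a point outside A of the smallest member properly containing A. If no such member
   exists, the other members are proper subsets of A, all missing i, and [None] does. *)
case: (pickP [pred C | (C \in SS) && (A \proper C)]) => [C0 h0|h0].
  case: (arg_minnP (fun C : {set I} => #|C|) h0) => B /= /andP[BS AB] mn.
  case/properP: (AB) => sAB [j jB jA]; exists (Some j) => //= C CS CA.
  case: (boolP (A \proper C)) => [AC|/(small _ CS CA) {}CA].
    rewrite (subsetP (proper_sub AC) _ iA); apply/esym.
    case/orP: (c _ _ BS CS) => [/subsetP s|s]; first exact: s.
    have := mn C; rewrite CS AC => /(_ isT) le.
    by have /eqP -> : C == B by rewrite eqEcard s.
  rewrite (negbTE (hi _ CS CA)); apply/esym/negbTE.
  by apply: contra jA; apply: (subsetP (proper_sub CA)).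
exists None => //= C CS CA; apply/negbTE/hi => //; apply: small => //.
by have := h0 C; rewrite /= CS /= => ->.
Qed.

End Chains.

(** * Combinations of indicators along a chain, and the layer-cake decomposition *)

Section LayerCake.
Variables (R : realDomainType) (I : finType).
Implicit Types (a b : {set I} -> R) (g : I -> R).

Definition weight a (i : I) : R := \sum_(A : {set I} | i \in A) a A.

Lemma weightE a i : weight a i = \sum_A a A * (i \in A)%:R.
Proof.
rewrite /weight big_mkcond; apply: eq_bigr => A _.
by case: ifP => _; rewrite ?mulr1 ?mulr0.
Qed.

Lemma weight_ge0 a i : (forall A, 0 <= a A) -> 0 <= weight a i.
Proof. by move=> h; apply: sumr_ge0. Qed.

Definition oweight a (o : option I) : R :=
  \sum_A a A * (oapp (mem A) false o)%:R.

Lemma oweightE a o : oweight a o = oapp (weight a) 0 o.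
Proof.
case: o => [i|] /=; first by rewrite weightE.
by rewrite /oweight big1 // => A _; rewrite mulr0.
Qed.

(** Every member of the chain other than A contains both points or neither, so its term cancels in
    the difference. Coefficients are thus integer combinations of weights, which later gives
    unimodularity. *)
Lemma weight_separation (SS : {set {set I}}) a A :
  is_chain SS -> A \in SS -> A != set0 -> (forall B, B \notin SS -> a B = 0) ->
  exists2 i, i \in A & exists2 o : option I, ~~ oapp (mem A) false o &
    a A = weight a i - oweight a o.
Proof.
move=> c hA A0 sa; have [i iA [o oA h]] := chain_separation c hA A0.
exists i => //; exists o => //.
rewrite weightE /oweight -sumrB (bigD1 A) //= iA (negbTE oA) mulr1 mulr0 subr0.
rewrite big1 ?addr0 // => C CA; case: (boolP (C \in SS)) => [CS|/sa ->].
  by rewrite (h C CS CA) subrr.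
by rewrite !mul0r subr0.
Qed.

(* Every drop of the weight from a point of A to a point outside A is at least
   [a A], while for [b] some such drop is at most [b A]. *)
Lemma weight_le (SS TT : {set {set I}}) a b : is_chain SS -> is_chain TT ->
  set0 \notin SS ->
  (forall A, 0 <= a A) -> (forall A, 0 <= b A) ->
  (forall A, A \notin SS -> a A = 0) -> (forall A, A \notin TT -> b A = 0) ->
  weight a =1 weight b -> forall A, a A <= b A.
Proof.
move=> cS /is_chainP cT S0 a0 b0 sa sb e A.
case: (boolP (A \in SS)) => [AS|/sa ->]; last exact: b0.
have A0 : A != set0 by apply: contra S0 => /eqP <-.
have eo o : oweight a o = oweight b o by rewrite !oweightE; case: o => //= i.
have lb i o : i \in A -> ~~ oapp (mem A) false o ->
    a A <= weight a i - oweight a o.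
  move=> iA oA; rewrite weightE /oweight -sumrB (bigD1 A) //= iA (negbTE oA).
  rewrite mulr1 mulr0 subr0 lerDl; apply: sumr_ge0 => C CA.
  rewrite -mulrBr; case: (boolP (C \in SS)) => [CS|/sa ->]; last by rewrite mul0r.
  apply: mulr_ge0 => //; rewrite subr_ge0 ler_nat.
  case/orP: ((is_chainP _ cS) _ _ AS CS) => /subsetP s; first by rewrite (s _ iA) leq_b1.
  have -> // : oapp (mem C) false o = false.
  by case: o oA => //= j jA; apply: contraNF jA; apply: s.
suff [i iA [o oA h]] : exists2 i, i \in A & exists2 o : option I,
    ~~ oapp (mem A) false o & weight b i - oweight b o <= b A.
  by apply: le_trans (lb _ _ iA oA) _; rewrite e eo.
(* If A is comparable with all of [TT], adding it keeps a chain, and the drop across A is exactly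
   [b A]. *)
case: (boolP [forall C in TT, (A \subset C) || (C \subset A)]).
  move=> /forall_inP cA.
  have cAT : is_chain (A |: TT).
    apply/is_chainP => B C /setU1P[->|BT] /setU1P[->|CT]; rewrite ?subxx //.
    - exact: cA.
    - by rewrite orbC; apply: cA.
    - exact: cT.
  have [||i iA [o oA h]] := @weight_separation _ b A cAT _ A0; first by rewrite setU11.
    by move=> B; rewrite !inE negb_or => /andP[_ /sb].
  by exists i => //; exists o => //; rewrite h.
(* Otherwise take C in [TT] incomparable with A, i in A but not C, and j in C but not A. A member of
   [TT] containing i must contain C, hence j, so this drop is at most 0. *)
rewrite negb_forall_in => /exists_inP[C CT]; rewrite negb_or.
case/andP=> /subsetPn[i iA iC] /subsetPn[j jC jA].
exists i => //; exists (Some j) => //; apply: le_trans (b0 A).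
rewrite oweightE /= subr_le0 !weightE; apply: ler_sum => D _.
case: (boolP (D \in TT)) => [DT|/sb ->]; last by rewrite !mul0r.
apply: ler_wpM2l => //; rewrite ler_nat.
case/orP: (cT _ _ CT DT) => /subsetP s; first by rewrite (s _ jC) leq_b1.
by rewrite (contraNF (s i) iC).
Qed.

Lemma weight_inj (SS TT : {set {set I}}) a b : is_chain SS -> is_chain TT ->
  set0 \notin SS -> set0 \notin TT ->
  (forall A, 0 <= a A) -> (forall A, 0 <= b A) ->
  (forall A, A \notin SS -> a A = 0) -> (forall A, A \notin TT -> b A = 0) ->
  weight a =1 weight b -> a =1 b.
Proof.
move=> cS cT S0 T0 a0 b0 sa sb e A; apply/eqP; rewrite eq_le.
by rewrite (weight_le cS cT) // (weight_le cT cS).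
Qed.

(* Induction on the support of [g], subtracting its least positive value. *)
Lemma layer_cake g : (forall i, 0 <= g i) -> exists a, [/\ forall A, 0 <= a A,
  forall A, a A != 0 -> exists2 j, 0 < g j & A = [set i | g j <= g i]
  & weight a =1 g].
Proof.
have [n] := ubnP #|[set i | g i != 0]|; elim: n g => // n IH g le g0.
case: (pickP [pred i | g i != 0]) => [i0 h0|h0]; last first.
  exists (fun=> 0); split=> // [A|i]; first by rewrite eqxx.
  by rewrite /weight big1 //; apply/esym/eqP; have := h0 i; rewrite /= => /negbFE.
have [j /= gj mn] := arg_minP g h0.
have gj0 : 0 < g j by rewrite lt_def gj g0.
(* As [g j] is the least positive value, [A0] is the support of g. *)
pose A0 := [set i | g j <= g i].
have A0E i : (i \in A0) = (g i != 0).
  rewrite inE; apply/idP/idP => [/(lt_le_trans gj0)|]; last exact: mn.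
  by rewrite lt_def => /andP[].
pose g' i := g i - g j * (i \in A0)%:R.
have g'0 i : 0 <= g' i.
  rewrite /g'; case: (boolP (i \in A0)) => [|_]; rewrite ?mulr1 ?mulr0 ?subr0 //.
  by rewrite inE subr_ge0.
have g'g i : 0 < g' i -> i \in A0.
  by rewrite /g' A0E; apply: contraTneq => ->; rewrite sub0r eqxx mulr0 oppr0 ltxx.
have lt' : (#|[set i | g' i != 0%R]| < n)%N.
  rewrite -ltnS; apply: leq_trans le; rewrite ltnS; apply: proper_card; apply/properP; split.
    apply/subsetP => i; rewrite !inE => gi.
    by rewrite -A0E; apply: g'g; rewrite lt_def gi g'0.
  exists j; rewrite !inE // /g'.
  by rewrite inE lexx mulr1 subrr eqxx.
have [a [a0 sa wa]] := IH g' lt' g'0.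
exists (fun A => a A + g j * (A == A0)%:R); split.
- by move=> A; rewrite addr_ge0 // mulr_ge0 // ltW.
- move=> A; case: (A =P A0) => [-> _|_]; first by exists j.
  (* On [A0] the functions g and g' differ by a constant, and off it both vanish, so superlevel sets
     of g' at positive levels are superlevel sets of g. *)
  rewrite mulr0 addr0 => /sa[k gk ->]; have kA := g'g _ gk.
  exists k; first by rewrite lt_def g0 -A0E kA.
  apply/setP => i; rewrite !inE /g' kA; case: (boolP (i \in A0)) => iA.
    by rewrite lerD2r.
  rewrite mulr0 subr0; move: iA; rewrite A0E negbK => /eqP ->.
  have gk0 : 0 < g k by rewrite lt_def g0 -A0E kA.
  by move: gk; rewrite /g' kA !leNgt gk0 => ->.
move=> i; rewrite weightE (eq_bigr (fun A => a A * (i \in A)%:R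
  + g j * (i \in A)%:R * (A == A0)%:R)); last first.
  by move=> A _; rewrite mulrDl -!mulrA [_%:R * _%:R]mulrC.
rewrite big_split /= -weightE wa (bigD1 A0) //= eqxx mulr1 big1 ?addr0; last first.
  by move=> A /negbTE ->; rewrite mulr0.
by rewrite /g' subrK.
Qed.

End LayerCake.

(** * Cones on indexed generators and simplicial systems *)

Section SimplicialCones.
Variables (R : realType) (V : lmodType R).

(** Coefficients live on all of I and vanish off S, so points of cones with different S are compared
    without reindexing. *)
Definition scone (I : finType) (v : I -> V) (S : {set I}) : set V :=
  [set x | exists a : I -> R, [/\ forall i, 0 <= a i,
     forall i, i \notin S -> a i = 0 & x = \sum_i a i *: v i]]%classic.

Lemma sum_transfer (I J : finType) (v : I -> V) (f : J -> I) (S : {set J})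
    (a : I -> R) : injective f -> (forall i, i \notin f @: S -> a i = 0) ->
  \sum_i a i *: v i = \sum_j a (f j) *: v (f j).
Proof.
move=> fI a0; rewrite (bigID (mem (f @: [set: J]))) /= addrC big1 ?add0r.
  rewrite big_imset; last exact: in2W.
  by apply: eq_bigl => i; rewrite inE.
move=> i hi; rewrite a0 ?scale0r //; apply: contra hi => /imsetP[j _ ->].
exact: imset_f.
Qed.

Lemma scone_imset (I J : finType) (v : I -> V) (f : J -> I) (S : {set J}) :
  injective f -> scone v (f @: S) = scone (v \o f) S.
Proof.
move=> fI; rewrite predeqE => x; split=> [[a [a0 sa ->]]|[c [c0 sc ->]]].
  exists (a \o f); split=> [j|j jS|] /=; first exact: a0.
    by apply: sa; rewrite mem_imset.
  exact: (sum_transfer v fI sa).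
(* The coefficients are carried along the injection f and extended by 0 off its image. *)
pose a i := oapp c 0 [pick j | f j == i].
have af j : a (f j) = c j.
  rewrite /a; case: pickP => [k /eqP/fI -> //|/(_ j)].
  by rewrite eqxx.
have sa i : i \notin f @: S -> a i = 0.
  rewrite /a; case: pickP => //= j /eqP <- jS; apply: sc.
  by rewrite mem_imset in jS.
exists a; split=> // [i|].
  by rewrite /a; case: pickP => //= j _; apply: c0.
by rewrite (sum_transfer v fI sa); apply: eq_bigr => j _; rewrite af.
Qed.

Lemma cone_scone n (v : 'I_n -> V) : cone v = scone v [set: 'I_n].
Proof.
rewrite predeqE => x; split=> -[a].
  by case=> a0 ->; exists a; split=> // i; rewrite inE.
by case=> a0 _ ->; exists a.
Qed.

Lemma scone_gen (I : finType) (v : I -> V) (S : {set I}) i : i \in S -> scone v S (v i).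
Proof.
move=> iS; exists (fun j => (j == i)%:R); split=> [j|j|]; first by [].
  by case: (j =P i) => // -> /negP.
rewrite (bigD1 i) //= eqxx scale1r big1 ?addr0 // => j /negbTE ->.
exact: scale0r.
Qed.

Lemma sconeS (I : finType) (v : I -> V) (S T : {set I}) :
  S \subset T -> (scone v S `<=` scone v T)%classic.
Proof.
move=> /fintype.subsetP ST x [a [a0 sa ->]]; exists a; split=> // i iT.
by apply: sa; apply: contra iT; apply: ST.
Qed.

Lemma scone0 (I : finType) (v : I -> V) : scone v set0 = [set 0]%classic.
Proof.
rewrite predeqE => x; split=> [[a [_ sa ->]]|->].
  by rewrite /= big1 // => i _; rewrite sa ?inE // scale0r.
by exists (fun=> 0); split=> //; rewrite big1 // => i _; rewrite scale0r.
Qed.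

Lemma ray_scone (I : finType) (v : I -> V) i : ray (v i) = scone v [set i].
Proof.
have fI : injective (fun _ : 'I_1 => i) by move=> j k _; rewrite (ord1 j) (ord1 k).
have -> : [set i] = (fun _ : 'I_1 => i) @: [set: 'I_1].
  by apply/setP => j; rewrite inE; apply/eqP/imsetP => [->|[]//]; exists ord0.
by rewrite scone_imset // -cone_scone.
Qed.

Definition baryv (I : finType) (v : I -> V) (A : {set I}) : V := \sum_(i in A) v i.

(** Exchanging the sums shows that [weight] converts coordinates in the subdivided generators into
    coordinates in the original ones. *)
Lemma sum_baryv (I : finType) (v : I -> V) (a : {set I} -> R) :
  \sum_A a A *: baryv v A = \sum_i weight a i *: v i.
Proof.
rewrite /baryv /weight; under eq_bigr do rewrite scaler_sumr big_mkcond.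
rewrite exchange_big; apply: eq_bigr => i _; rewrite scaler_suml.
by rewrite [RHS]big_mkcond.
Qed.

(** [dual_functional] is linear independence on a face, in terms of functionals because [face] is.
    [coordinates_inj] compares two faces, so that their cones meet exactly in the cone of the
    intersection. [unimodular] says that lattice points in the span of a face are those with integer
    coordinates. *)
Record simplicial_system (L : set V) (I : finType) (v : I -> V)
    (K : pred {set I}) : Prop := SimplicialSystem {
  face_set0 : K set0;
  face_closed : forall S T : {set I}, T \subset S -> K S -> K T;
  dual_functional : forall S i, K S -> i \in S -> exists2 l : {linear V -> R^o},
    l (v i) = 1 & forall j, j \in S -> j != i -> l (v j) = 0;
  coordinates_inj : forall (S T : {set I}) (a b : I -> R), K S -> K T ->
    (forall i, 0 <= a i) -> (forall i, 0 <= b i) ->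
    (forall i, i \notin S -> a i = 0) -> (forall i, i \notin T -> b i = 0) ->
    \sum_i a i *: v i = \sum_i b i *: v i -> a =1 b;
  unimodular : forall (S : {set I}) (a : I -> R), K S ->
    (forall i, i \notin S -> a i = 0) ->
    L (\sum_i a i *: v i) <-> forall i, a i \is a Num.int }.

Definition fan_of (I : finType) (v : I -> V) (K : pred {set I}) : set (set V) :=
  [set C | exists2 S, K S & C = scone v S]%classic.

(** The order complex of the nonempty faces of K, that is, its abstract barycentric subdivision. *)
Definition baryK (I : finType) (K : pred {set I}) : pred {set {set I}} :=
  [pred SS | is_chain SS && [forall A in SS, K A && (A != set0)]].

Lemma baryKP (I : finType) (K : pred {set I}) SS :
  reflect (is_chain SS /\ forall A, A \in SS -> K A /\ A != set0) (baryK K SS).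
Proof.
apply: (iffP andP) => -[c h]; split=> //.
  by move=> A /(forall_inP h)/andP.
by apply/forall_inP => A /h[-> ->].
Qed.

(** * Faces, primitive generators and subdivision of a simplicial system *)

Section System.
Variables (L : set V) (I : finType) (v : I -> V) (K : pred {set I}).

Hypothesis sys : simplicial_system L v K.

Lemma gen_neq0 S i : K S -> i \in S -> v i <> 0.
Proof.
move=> KS iS v0; have [l l1 _] := dual_functional sys KS iS.
by move/eqP: l1; rewrite v0 linear0 eq_sym oner_eq0.
Qed.

Lemma gen_inj S : K S -> {in S &, injective v}.
Proof.
move=> KS i j iS jS e; case: (eqVneq i j) => // ij.
have [l l1 l0] := dual_functional sys KS iS.
have := l0 j jS; rewrite eq_sym -e l1 => /(_ ij)/eqP.
by rewrite oner_eq0.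
Qed.

(** For i in S, the coordinates of [v i] in the cone of T must agree with those in its own ray, so i
    lies in T. *)
Lemma scone_subset S T : K S -> K T ->
  (scone v S `<=` scone v T)%classic -> S \subset T.
Proof.
move=> KS KT sub; apply/fintype.subsetP => i iS.
have [a [a0 sa e]] := sub _ (scone_gen v iS).
have KI : K [set i] by apply: (face_closed sys _ KS); rewrite sub1set.
have b0 j : 0 <= (j == i)%:R :> R by [].
have sb j : j \notin [set i] -> (j == i)%:R = 0 :> R by rewrite inE => /negbTE ->.
have eb : \sum_j a j *: v j = \sum_j (j == i)%:R *: v j.
  rewrite -e [RHS](bigD1 i) //= eqxx scale1r big1 ?addr0 // => j /negbTE ->.
  exact: scale0r.
have eab := coordinates_inj sys KT KI a0 b0 sa sb eb.
by apply: contraT => /sa /eqP; rewrite eab eqxx oner_eq0.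
Qed.

(** The supporting value on a cone is 0, so the functional is nonpositive on the generators. It
    vanishes on a nonnegative combination only when the combination is supported on generators where
    it is 0. *)
Lemma face_scone_sub S F : face (scone v S) F ->
  exists2 T : {set I}, T \subset S & F = scone v T.
Proof.
case=> -[x0 Fx0] [l [b [lb FE]]].
have b_ge0 : 0 <= b.
  rewrite -(linear0 l); apply: lb; exists (fun=> 0); split=> //.
  by rewrite big1 // => i _; rewrite scale0r.
(* Doubling the point [x0] of the face stays in the cone, so twice b is at most b. *)
have b_le0 : b <= 0.
  move: Fx0; rewrite FE => -[[a [a0 sa xE]] /= lx0].
  have : l (2%:R *: x0) <= b.
    apply: lb; exists (fun i => 2%:R * a i); split=> [i|i /sa ->|].
    - by rewrite mulr_ge0.
    - by rewrite mulr0.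
    - by rewrite xE scaler_sumr; apply: eq_bigr => i _; rewrite scalerA.
  rewrite linearZ /= lx0 /GRing.scale /=; lra.
have bE : b = 0 by apply/eqP; rewrite eq_le b_le0.
have lv i : i \in S -> l (v i) <= 0.
  by move=> iS; rewrite -bE; apply/lb/scone_gen.
have lsum (a : I -> R) : l (\sum_i a i *: v i) = \sum_i a i * l (v i).
  by rewrite linear_sum; apply: eq_bigr => i _; rewrite linearZ.
exists [set i in S | l (v i) == 0].
  by apply/fintype.subsetP => i; rewrite inE => /andP[].
rewrite FE bE predeqE => x; split.
  case=> -[a [a0 sa ->]] /=; rewrite lsum => /eqP.
  rewrite -oppr_eq0 -sumrN psumr_eq0 => [|i _]; last first.
    case: (boolP (i \in S)) => [/lv h|/sa ->]; last by rewrite mul0r oppr0.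
    by rewrite -mulrN mulr_ge0 // oppr_ge0.
  move=> /allP h; exists a; split=> // i; rewrite inE negb_and.
  case/orP=> [/sa //|li]; have := h i; rewrite mem_index_enum oppr_eq0 mulf_eq0.
  by rewrite (negbTE li) orbF => /(_ isT)/eqP.
case=> a [a0 sa ->]; split.
  by exists a; split=> // i iS; apply: sa; rewrite inE (negbTE iS).
rewrite /= lsum big1 // => i _.
case: (boolP (i \in [set i in S | l (v i) == 0])) => [|/sa ->]; last by rewrite mul0r.
by rewrite inE => /andP[_ /eqP ->]; rewrite mulr0.
Qed.

(** Conversely, minus the sum of the functionals dual to [S :\: T] is 0 on the generators in T and
    -1 on the others in S, so it exposes the cone of T. *)
Lemma face_sconeP S F : K S ->
  face (scone v S) F <-> exists2 T : {set I}, T \subset S & F = scone v T.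
Proof.
move=> KS; split=> [/face_scone_sub//|[T TS ->]].
have /boolp.choice[ls hls] : forall i, exists l : {linear V -> R^o}, i \in S ->
    l (v i) = 1 /\ forall j, j \in S -> j != i -> l (v j) = 0.
  move=> i; case: (boolP (i \in S)) => [iS|_]; last by exists \0.
  by have [l l1 l0] := dual_functional sys KS iS; exists l.
have [l lv] : exists l : {linear V -> R^o},
    forall j, j \in S -> l (v j) = - (j \in S :\: T)%:R.
  have l_lin : linear (fun x => - \sum_(i in S :\: T) ls i x : R^o).
    move=> c x y; rewrite scalerN -opprD scaler_sumr -big_split /=.
    by congr (- _); apply: eq_bigr => i _; rewrite linearP.
  pose l0 := GRing.isLinear.Build R V R^o _ _ l_lin.
  pose l : {linear V -> R^o} :=
    HB.pack (fun x => - \sum_(i in S :\: T) ls i x : R^o) l0.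
  exists l => j jS; rewrite /l /=; congr (- _).
  case: (boolP (j \in S :\: T)) => jT.
    rewrite (bigD1 j) //= (hls j jS).1 big1 ?addr0 // => i /andP[].
    by rewrite inE => /andP[_ iS] ij; apply: (hls i iS).2 => //; rewrite eq_sym.
  rewrite big1 // => i iST; have /setDP[iS _] := iST.
  by apply: (hls i iS).2 => //; apply: contraNneq jT => ->.
have lsum (a : I -> R) : (forall i, i \notin S -> a i = 0) ->
    l (\sum_i a i *: v i) = - \sum_i a i * (i \in S :\: T)%:R.
  move=> sa; rewrite linear_sum -sumrN; apply: eq_bigr => i _.
  have -> : l (a i *: v i) = a i * l (v i) by rewrite linearZ.
  case: (boolP (i \in S)) => [iS|/sa ->]; last by rewrite !mul0r oppr0.
  by rewrite lv // mulrN.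
split; first by exists 0, (fun=> 0); split=> //; rewrite big1 // => i _; rewrite scale0r.
exists l, 0; split=> [x [a [a0 sa ->]]|].
  by rewrite lsum // oppr_le0; apply: sumr_ge0 => i _; rewrite mulr_ge0.
rewrite predeqE => x; split.
  move=> xT; split; first exact: sconeS xT.
  case: xT => a [a0 sa ->] /=; rewrite lsum.
    rewrite big1 ?oppr0 // => i _; rewrite inE.
    by case: (boolP (i \in T)) => [_|/sa ->]; rewrite ?mul0r ?mulr0.
  by move=> i iS; apply: sa; apply: contra iS; apply: (fintype.subsetP TS).
case=> -[a [a0 sa ->]] /=; rewrite lsum // => /eqP.
rewrite oppr_eq0 psumr_eq0 => [/allP h|i _]; last by rewrite mulr_ge0.
exists a; split=> // i iT; case: (boolP (i \in S)) => [iS|/sa //].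
have := h i; rewrite mem_index_enum inE iT iS mulr1 => /(_ isT).
by move/eqP.
Qed.

Lemma scaled_gen S c i : K S -> i \in S -> L (c *: v i) <-> c \is a Num.int.
Proof.
move=> KS iS; pose b j := c * (j == i)%:R.
have sb j : j \notin S -> b j = 0.
  by rewrite /b; case: (j =P i) => [->|_ _]; rewrite ?iS ?mulr0.
have -> : c *: v i = \sum_j b j *: v j.
  rewrite (bigD1 i) //= big1 ?addr0 /b ?eqxx ?mulr1 // => j /negbTE ->.
  by rewrite mulr0 scale0r.
rewrite (unimodular sys KS sb); split=> [/(_ i)|cZ j]; rewrite /b.
  by rewrite eqxx mulr1.
by rewrite rpredM // rpred_nat.
Qed.

(** If [v i] is n times a lattice vector u, then u is the multiple of [v i] by the inverse of n;
    unimodularity makes this inverse an integer, so n is 1. *)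
Lemma primitive_gen S i : K S -> i \in S -> primitive L (v i).
Proof.
move=> KS iS; have v0 := gen_neq0 KS iS; split=> //.
  by rewrite -[v i]scale1r; apply/(scaled_gen _ KS iS).
move=> u n Lu vE; have n0 : n != 0%N.
  by apply: contra_notN v0 => /eqP n0; rewrite vE n0 mulr0n.
have nR0 : n%:R != 0 :> R by rewrite pnatr_eq0.
have : L ((n%:R^-1 : R) *: v i) by rewrite vE -scaler_nat scalerA mulVf // scale1r.
move=> /(scaled_gen _ KS iS)/intrP[m mE].
have : (n%:Z * m)%:~R = 1 :> R by rewrite intrM -mE mulfV.
move/eqP; rewrite -[1]/(1%:~R) eqr_int => /eqP e.
have /eqP := congr1 absz e.
by rewrite abszM muln_eq1 => /andP[/eqP].
Qed.

(** A ray that is a face is the cone of some T. A nonzero coordinate i of its primitive generator w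
    makes w a positive multiple of [v i]; the factor is a natural number by unimodularity, and 1 by
    primitivity of w. *)
Lemma ray_generators_scone S : K S ->
  ray_generators L (scone v S) = (v @` [set` S])%classic.
Proof.
move=> KS; rewrite predeqE => w; split; last first.
  case=> i /= iS <-; split; first exact: (primitive_gen KS iS).
  apply/(face_sconeP _ KS); exists [set i]; first by rewrite sub1set.
  exact: ray_scone.
case=> -[Lw w0 wprim] /(face_scone_sub)[T TS rE].
have : scone v T w.
  by rewrite -rE /ray cone_scone; apply: (@scone_gen _ (fun=> w) _ ord0); rewrite inE.
case=> a [a0 sa wE].
have [i ai] : exists i, a i != 0.
  apply/existsP; apply: contra_notT w0; rewrite negb_exists => /forallP h.
  by rewrite wE big1 // => i _; move: (h i); rewrite negbK => /eqP ->; rewrite scale0r.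
have iT : i \in T by apply: contraNT ai => /sa ->.
have iS : i \in S := fintype.subsetP TS _ iT.
have [c [c0 viE]] : ray w (v i) by rewrite rE; apply: scone_gen.
move: viE; rewrite big_ord1 => viE.
have c_neq0 : c ord0 != 0.
  by apply: contra_notN (gen_neq0 KS iS) => /eqP c00; rewrite viE c00 scale0r.
have wvi : w = (c ord0)^-1 *: v i by rewrite viE scalerA mulVf // scale1r.
exists i => //; move: Lw; rewrite wvi => /(scaled_gen _ KS iS)/intrP[m mE].
have m0 : (0 <= m)%R by rewrite -(ler0z R) -mE invr_ge0.
case: m m0 mE => // m _ mE.
have Lvi : L (v i) by rewrite -[v i]scale1r; apply/(scaled_gen _ KS iS).
have := wprim _ m Lvi; rewrite wvi mE scaler_nat => /(_ erefl) ->.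
by rewrite mulr1n.
Qed.

Lemma rho_scone S : K S -> rho L (scone v S) = baryv v S.
Proof.
move=> KS; rewrite /rho ray_generators_scone // fsbig_image; last first.
  by move=> i j; rewrite !in_setE => iS jS; apply: (gen_inj KS).
rewrite (@fsbigE _ _ _ _ _ (enum S) v (enum_uniq _)).
- rewrite /baryv big_enum_cond /=; apply: eq_bigl => i.
  by apply/andb_idr => iS; rewrite in_setE.
- by move=> i /=; rewrite mem_enum.
- by move=> i iS; rewrite mem_enum iS.
Qed.

Lemma scone_neq0 S : K S -> S != set0 -> scone v S <> [set 0]%classic.
Proof.
move=> KS /set0Pn[i iS] e; apply: (gen_neq0 KS iS).
by have := scone_gen v iS; rewrite e.
Qed.

Lemma scone_proper S T : K S -> K T ->
  (scone v S `<` scone v T)%classic <-> S \proper T.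
Proof.
move=> KS KT; split=> [[sub nsub]|/properP[sub [i iT iS]]].
  rewrite properE (scone_subset KS KT sub) /=.
  by apply: contra_notN nsub; apply: sconeS.
split; first exact: sconeS.
by move=> /(scone_subset KT KS)/fintype.subsetP/(_ _ iT); rewrite (negbTE iS).
Qed.

(** Strict inclusion of cones amounts to strict inclusion of their index sets, so chains of nonzero
    cones correspond to chains of nonempty faces. The empty chain accounts for the zero cone. *)
Lemma subdivision_fan :
  barycentric_subdivision L (fan_of v K) = fan_of (baryv v) (baryK K).
Proof.
rewrite predeqE => C; split.
  case=> [->|[k [tau [tauK mono ->]]]].
    exists set0; last by rewrite scone0.
    by apply/baryKP; split=> [|A]; [apply/is_chainP => A|]; rewrite inE.
  have /boolp.choice[f hf] : forall i, exists S, K S /\ tau i = scone v S.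
    by move=> i; have [[S KS ->] _] := tauK i; exists S.
  have fmono (i j : 'I_k.+1) : (i < j)%N -> f i \proper f j.
    by move=> /mono; rewrite !(hf _).2 => /(scone_proper (hf i).1 (hf j).1).
  have fI : injective f.
    move=> i j e; apply/val_inj/eqP; case: ltngtP => // /fmono.
      by rewrite e properxx.
    by rewrite e properxx.
  exists (f @: [set: 'I_k.+1]).
    apply/baryKP; split=> [|A /imsetP[i _ ->]].
      apply/is_chainP => A B /imsetP[i _ ->] /imsetP[j _ ->].
      case: (ltngtP i j) => [/fmono/proper_sub ->|/fmono/proper_sub ->|/val_inj ->] //.
        by rewrite orbT.
      by rewrite subxx.
    split; first by have [] := hf i.
    apply/negP => /eqP f0; have [_] := tauK i; apply.
    by rewrite (hf i).2 f0 scone0.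
  rewrite scone_imset // cone_scone; congr scone; apply/funext => i /=.
  by rewrite (hf i).2 rho_scone // (hf i).1.
case=> SS /baryKP[c hSS] ->.
case: (set_0Vmem SS) => [->|[A0 AS0]]; first by left; rewrite scone0.
(* A nonempty chain is listed by cardinality, which is strictly increasing order since its members
   are comparable. *)
right; pose s := sort (fun A B : {set I} => #|A| <= #|B|)%N (enum SS).
have sS A : (A \in s) = (A \in SS) by rewrite mem_sort mem_enum.
have su : uniq s by rewrite sort_uniq enum_uniq.
have ss : sorted (fun A B : {set I} => #|A| <= #|B|)%N s.
  by apply: sort_sorted => A B; apply: leq_total.
have [k sk] : exists k, size s = k.+1.
  by move: (sS A0); rewrite AS0; case: (s) => // A s' _; exists (size s').
have tS (i : 'I_k.+1) : nth set0 s i \in SS by rewrite -sS mem_nth // sk.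
pose f (i : 'I_k.+1) := nth set0 s i.
have fI : injective f.
  move=> i j /eqP; rewrite nth_uniq ?sk // => /eqP; exact: val_inj.
have fS : f @: [set: 'I_k.+1] = SS.
  apply/setP => A; apply/imsetP/idP => [[i _ ->]|]; first exact: tS.
  rewrite -sS => As; have iA : (index A s < k.+1)%N by rewrite -sk index_mem.
  by exists (Ordinal iA); rewrite // /f nth_index.
exists k, (fun i => scone v (f i)); split.
- by move=> i; have [Ki ne] := hSS _ (tS i); split; [exists (f i)|apply: scone_neq0].
- move=> i j ij; apply/scone_proper; [by case: (hSS _ (tS i))|by case: (hSS _ (tS j))|].
  have le : (#|f i| <= #|f j|)%N.
    apply: (sorted_leq_nth _ _ _ ss) => //; rewrite ?inE ?sk //; last exact: ltnW.
    by move=> A B D; apply: leq_trans.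
  have ne : f i != f j by apply/eqP => /fI e; rewrite e ltnn in ij.
  rewrite properEneq ne /=; case/orP: (is_chainP _ c _ _ (tS i) (tS j)) => // sub.
  by move: ne; rewrite eq_sym eqEcard sub le.
rewrite -{1}fS scone_imset // cone_scone; congr scone; apply/funext => i /=.
by rewrite rho_scone //; case: (hSS _ (tS i)).
Qed.

(** The largest member works. Hence each cone of the subdivision lies inside one original cone,
    where the axioms for v apply. *)
Lemma baryK_cover SS : baryK K SS ->
  exists2 S : {set I}, K S & forall A, A \in SS -> A \subset S.
Proof.
case/baryKP=> c h; case: (set_0Vmem SS) => [->|[A0 h0]].
  by exists set0; [exact: face_set0 sys|move=> A; rewrite inE].
have [A /= AS mx] := arg_maxnP (fun C : {set I} => #|C|) h0.
exists A => [|B BS]; first by case: (h _ AS).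
case/orP: (is_chainP _ c _ _ AS BS) => // s.
by have /eqP -> : A == B by rewrite eqEcard s mx.
Qed.

Lemma baryK_face (S T : {set {set I}}) : T \subset S -> baryK K S -> baryK K T.
Proof.
move=> TS /baryKP[c h]; apply/baryKP; split; first exact: is_chain_sub c.
by move=> A /(fintype.subsetP TS)/h.
Qed.

Lemma baryK_set0 SS : baryK K SS -> set0 \notin SS.
Proof. by case/baryKP=> _ h; apply/negP => /h[_]; rewrite eqxx. Qed.

Lemma weight_supp (SS : {set {set I}}) (S : {set I}) (a : {set I} -> R) :
  (forall A, A \in SS -> A \subset S) ->
  (forall A, A \notin SS -> a A = 0) -> forall i, i \notin S -> weight a i = 0.
Proof.
move=> h sa i iS; rewrite /weight big1 // => A iA; apply: sa.
by apply: contra iS => /h/fintype.subsetP; apply.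
Qed.

(** The axioms are pulled back through [sum_baryv]: duals come from [chain_separation], uniqueness
    from [weight_inj], integrality from [weight_separation]. The result can be fed to the same
    construction again. *)
Lemma subdivision_system : simplicial_system L (baryv v) (baryK K).
Proof.
split.
- by apply/baryKP; split=> [|A]; [apply/is_chainP => A|]; rewrite inE.
- by move=> S T; apply: baryK_face.
- move=> SS A KSS ASS; have [c hSS] := baryKP _ _ KSS.
  have [S KS SSS] := baryK_cover KSS.
  have [_ A0] := hSS _ ASS.
  have [i iA [o oA sep]] := chain_separation c ASS A0.
  (* The functional dual to [v j] tests whether j belongs to B; the difference of two such tests at
     separating points is dual to A. *)
  have dual j : j \in S -> exists l : {linear V -> R^o},
      forall B, B \in SS -> l (baryv v B) = (j \in B)%:R.
    move=> jS; have [l l1 l0] := dual_functional sys KS jS; exists l => B BSS.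
    rewrite /baryv linear_sum; case: (boolP (j \in B)) => jB.
      rewrite (bigD1 j) //= l1 big1 ?addr0 // => k /andP[kB kj].
      by apply: l0 => //; apply: (fintype.subsetP (SSS _ BSS)).
    rewrite big1 // => k kB; apply: l0; last by apply: contraNneq jB => <-.
    exact: (fintype.subsetP (SSS _ BSS)).
  have [l1 hl1] := dual i (fintype.subsetP (SSS _ ASS) _ iA).
  (* When o is [None] or a point outside S, it lies in no member of [SS], and the zero functional
     serves. *)
  have [l2 hl2] : exists l : {linear V -> R^o},
      forall B, B \in SS -> l (baryv v B) = (oapp (mem B) false o)%:R.
    case: (o) => [j|] /=; last by exists \0.
    case: (boolP (j \in S)) => [/dual//|jS]; exists \0 => B /SSS/fintype.subsetP BS.
    by rewrite (contraNF (BS _) jS).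
  exists (l1 \- l2) => [|B BSS BA] /=.
    by rewrite hl1 // hl2 // iA (negbTE oA) subr0.
  by rewrite hl1 // hl2 // sep // subrr.
- move=> SS TT a b KSS KTT a0 b0 sa sb; rewrite !sum_baryv => e.
  have [cS _] := baryKP _ _ KSS; have [cT _] := baryKP _ _ KTT.
  apply: (weight_inj cS cT) => //; try exact: baryK_set0.
  have [S KS SSS] := baryK_cover KSS; have [T KT TTT] := baryK_cover KTT.
  apply: (coordinates_inj sys KS KT) e => i; try exact: weight_ge0.
    exact: (weight_supp SSS sa).
  exact: (weight_supp TTT sb).
- move=> SS a KSS sa; rewrite sum_baryv; have [c hSS] := baryKP _ _ KSS.
  have [S KS SSS] := baryK_cover KSS.
  rewrite (unimodular sys KS (weight_supp SSS sa)); split=> [wZ A|aZ i]; last first.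
    by apply: rpred_sum => A _.
  case: (boolP (A \in SS)) => [AS|/sa -> //].
  have [i _ [o _ ->]] := weight_separation c AS (hSS _ AS).2 sa.
  by rewrite oweightE rpredB //; case: (o) => /=.
Qed.

End System.

End SimplicialCones.

(** * Sorting permutations and upper sets *)

Section Sorting.
Variable n : nat.

Lemma sort_perm (f : 'I_n -> nat) :
  exists p : 'S_n, forall i j, (f i < f j)%N -> (p i < p j)%N.
Proof.
(* The lexicographic order on pairs (f i, i) as one number, since i < n. Ties being broken, the
   ranks are distinct and define p. *)
pose key i := (f i * n + i)%N.
pose below i := [set j | (key j < key i)%N].
have mono i j : (key i < key j)%N -> (#|below i| < #|below j|)%N.
  move=> ij; apply: proper_card; apply/properP; split.
    by apply/fintype.subsetP => k; rewrite !inE => /ltn_trans; apply.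
  by exists i; rewrite inE ?ltnn.
have lt_key i j : (f i < f j)%N -> (key i < key j)%N.
  by rewrite /key => h; have := ltn_ord i; have := ltn_ord j; nia.
have rank_lt i : (#|below i| < n)%N.
  rewrite -[X in (_ < X)%N]card_ord -cardsT; apply: proper_card; apply/properP.
  by split; [exact: finset.subsetT|exists i; rewrite ?inE ?ltnn].
have rank_inj : injective (fun i => Ordinal (rank_lt i)).
  move=> i j /(congr1 val) /= e.
  have ek : key i = key j.
    by case: (ltngtP (key i) (key j)) => // /mono; rewrite e ltnn.
  apply: val_inj; case: (ltngtP (f i) (f j)) => [/lt_key|/lt_key|fij].
  - by rewrite ek ltnn.
  - by rewrite ek ltnn.
  - by move: ek; rewrite /key fij => /addnI.
by exists (perm rank_inj) => i j ij; rewrite !permE /=; apply/mono/lt_key.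
Qed.

(** Points are sorted by the number of members missing them. If A contains i but not j, any member
    missing i lies inside A and so misses j, while A misses only j. *)
Lemma chain_perm (SS : {set {set 'I_n}}) : is_chain SS ->
  exists p : 'S_n, forall A i j, A \in SS -> i \in A -> j \notin A -> (p i < p j)%N.
Proof.
move=> /is_chainP c.
have [p hp] := sort_perm (fun i => #|[set B in SS | i \notin B]|).
exists p => A i j AS iA jA; apply: hp; apply: proper_card; apply/properP; split.
  apply/fintype.subsetP => B; rewrite !inE => /andP[BS iB]; rewrite BS /=.
  case/orP: (c _ _ AS BS) => /fintype.subsetP s; first by rewrite (s _ iA) in iB.
  by apply: contra jA; apply: s.
by exists A; rewrite !inE AS ?jA // iA.
Qed.

Definition upsets (t : 'S_n) : {set {set 'I_n}} :=
  [set B : {set 'I_n} | (B != set0) &&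
     [forall k, forall l, (t k <= t l)%N ==> (k \in B) ==> (l \in B)]].

Lemma upsetsP (t : 'S_n) (B : {set 'I_n}) : reflect
  (B != set0 /\ forall k l, (t k <= t l)%N -> k \in B -> l \in B) (B \in upsets t).
Proof.
rewrite inE; apply: (iffP andP) => -[-> h]; split=> //.
  move=> k l kl kB; move/forallP: h => /(_ k)/forallP/(_ l).
  by rewrite kl kB.
by apply/forallP => k; apply/forallP => l; apply/implyP => kl; apply/implyP; apply: h.
Qed.

Lemma upsets_chain t : is_chain (upsets t).
Proof.
apply/is_chainP => A B /upsetsP[_ hA] /upsetsP[_ hB].
case: (boolP (A \subset B)) => //= /subsetPn[i iA iB].
apply/fintype.subsetP => j jB; apply: hA iA.
by rewrite leqNgt; apply: contra iB => /ltnW ji; apply: hB jB.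
Qed.

(** The layer-cake decomposition for functions nondecreasing along t: their superlevel sets are
    upper sets of t, and indicators of upper sets are nondecreasing. *)
Lemma sorted_scone (R : realType) (V : lmodType R) (u : 'I_n -> V) (t : 'S_n) :
  [set x | exists c : 'I_n -> R, [/\ forall k, 0 <= c k,
     forall i j : 'I_n, (i <= j)%N -> c (t^-1%g i) <= c (t^-1%g j)
   & x = \sum_k c k *: u k]]%classic = scone (baryv u) (upsets t).
Proof.
rewrite predeqE => x; split=> -[].
  move=> c [c0 cs ->]; have [a [a0 sa wa]] := layer_cake c0.
  have cmono k l : (t k <= t l)%N -> c k <= c l.
    by move=> /cs; rewrite !permK.
  exists a; split=> // [A|]; last first.
    by rewrite sum_baryv; apply: eq_bigr => k _; rewrite wa.
  apply: contraNeq => /sa[j cj ->]; apply/upsetsP; split=> [|k l kl].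
    by apply/set0Pn; exists j; rewrite inE.
  by rewrite !inE => /le_trans; apply; apply: cmono.
move=> a [a0 sa ->]; exists (weight a); split=> [k|i j ij|].
- exact: weight_ge0.
- rewrite !weightE; apply: ler_sum => A _.
  case: (boolP (A \in upsets t)) => [/upsetsP[_ hA]|/sa ->]; last by rewrite !mul0r.
  apply: ler_wpM2l => //; rewrite ler_nat.
  case: (boolP (t^-1%g i \in A)) => // iA.
  by rewrite (hA _ _ _ iA) // !permKV.
- by rewrite sum_baryv.
Qed.

End Sorting.

(** * The quotient space and the normal fan of the simplex *)

Section BraidFans.
Variables (R : realType) (d : nat).
Implicit Types (x y : 'rV[R]_d.+1) (p : 'S_d.+1).

Lemma toW_eqP x y : toW x = toW y <-> exists c, forall i, x 0 i - y 0 i = c.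
Proof.
rewrite /toW; split.
  move/proj_quotv_eqP/vlineP => [c e]; exists c => i.
  by have := congr1 (fun z : 'rV_d.+1 => z 0 i) e; rewrite !mxE mulr1.
move=> [c h]; apply/proj_quotv_eqP/vlineP; exists c; apply/rowP => i.
by rewrite !mxE mulr1 h.
Qed.

Lemma toW_sum (J : finType) (a : J -> R) (z : J -> 'rV[R]_d.+1) :
  \sum_j a j *: (toW (z j) : W R d) = toW (\sum_j a j *: z j).
Proof.
by rewrite /toW linear_sum; apply: eq_bigr => j _; rewrite linearZ.
Qed.

Lemma toW_surj (w : W R d) : exists x, toW x = w.
Proof. exact: proj_quotv_surj. Qed.

(** The outer normal of the facet where coordinate j vanishes; normal cones here collect functionals
    maximal on a face, hence the sign. *)
Definition simplex_ray (j : 'I_d.+1) : W R d := toW (- delta_mx 0 j).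

Lemma sum_simplex_ray (a : 'I_d.+1 -> R) :
  \sum_j a j *: simplex_ray j = toW (\row_j - a j).
Proof.
rewrite toW_sum; congr toW; apply/rowP => j; rewrite summxE (bigD1 j) //= big1.
  by rewrite !mxE !eqxx mulrN1 addr0.
by move=> k kj; rewrite !mxE eqxx eq_sym (negbTE kj) oppr0 mulr0.
Qed.

(** Differences of coordinates are unchanged by the all-one vector, so the chosen representative is
    immaterial; they supply the functionals on the quotient. *)
Definition coord_diff (i j : 'I_d.+1) (w : W R d) : R^o :=
  let x : 'rV[R]_d.+1 := projT1 (cid (toW_surj w)) in x 0 i - x 0 j.

Lemma coord_diffE i j x : coord_diff i j (toW x) = x 0 i - x 0 j.
Proof.
rewrite /coord_diff; case: cid => y /= /toW_eqP[c h].
have := h i; have := h j; lra.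
Qed.

Lemma coord_diff_linear i j : linear (coord_diff i j).
Proof.
move=> a v w; have [x <-] := toW_surj v; have [y <-] := toW_surj w.
have -> : a *: toW x + toW y = toW (a *: x + y) by rewrite /toW linearP.
rewrite !coord_diffE !mxE /GRing.scale /=; ring.
Qed.

HB.instance Definition _ i j := GRing.isLinear.Build R (W R d) R^o _
  (coord_diff i j) (coord_diff_linear i j).

(** The boundary complex of the simplex. *)
Definition proper_sets : pred {set 'I_d.+1} := [pred S | S != [set: 'I_d.+1]].

Lemma proper_setsP (S : {set 'I_d.+1}) : reflect (exists j, j \notin S) (proper_sets S).
Proof.
apply: (iffP idP) => [|[j jS]].
  rewrite /proper_sets /= -finset.subTset => /subsetPn[j _ jS].
  by exists j.
by apply: contraNneq jS => ->; rewrite inE.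
Qed.

(** A proper S misses an index j. Combinations supported on S vanish there, which pins down the
    representative modulo the all-one vector. *)
Lemma simplex_system :
  simplicial_system (latticeW R d) simplex_ray proper_sets.
Proof.
split.
- by apply/proper_setsP; exists ord0; rewrite inE.
- move=> S T TS /proper_setsP[j jS]; apply/proper_setsP; exists j.
  by apply: contra jS; apply: (fintype.subsetP TS).
- move=> S i /proper_setsP[j jS] iS; exists (coord_diff j i) => [|k kS ki] /=.
    have ji : j != i by apply: contraNneq jS => ->.
    by rewrite coord_diffE !mxE !eqxx (negbTE ji) oppr0 sub0r opprK.
  have jk : j != k by apply: contraNneq jS => ->.
  by rewrite coord_diffE !mxE !eqxx (negbTE jk) [i == k]eq_sym (negbTE ki) oppr0 subrr.
- move=> S T a b /proper_setsP[i iS] /proper_setsP[j jT] a0 b0 sa sb.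
  rewrite !sum_simplex_ray => /toW_eqP[c h].
  have := h i; have := h j; rewrite !mxE (sa i) // (sb j) // => hj hi.
  (* The index missed by S gives c >= 0, the one missed by T gives c <= 0. *)
  have c0 : c = 0 by have := a0 j; have := b0 i; lra.
  by move=> k; have := h k; rewrite !mxE c0; lra.
- move=> S a /proper_setsP[j jS] sa; rewrite sum_simplex_ray; split.
    case=> y yZ /toW_eqP[c h] i.
    have := h j; have := h i; rewrite !mxE (sa j) // => hi hj.
    have -> : a i = y 0 j - y 0 i by lra.
    by rewrite rpredB.
  by move=> aZ; exists (\row_j - a j) => // i; rewrite mxE rpredN.
Qed.

Lemma dot_sum n (w : 'rV[R]_d.+1) (a : 'I_n -> R) (z : 'I_n -> 'rV[R]_d.+1) :
  dot w (\sum_i a i *: z i) = \sum_i a i * dot w (z i).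
Proof.
rewrite /dot; under [RHS]eq_bigr do rewrite mulr_sumr.
rewrite exchange_big; apply: eq_bigr => j _; rewrite summxE mulr_sumr.
by apply: eq_bigr => i _; rewrite !mxE mulrCA.
Qed.

Lemma dot_delta (w : 'rV[R]_d.+1) i : dot w (delta_mx 0 i) = w 0 i.
Proof.
rewrite /dot (bigD1 i) //= mxE !eqxx mulr1 big1 ?addr0 // => j /negbTE ji.
by rewrite mxE ji andbF mulr0.
Qed.

Lemma standard_simplex_vertex i : standard_simplex R d (delta_mx 0 i).
Proof.
exists (fun j => (j == i)%:R); split=> [//||].
  by rewrite (bigD1 i) //= eqxx big1 ?addr0 // => j /negbTE ->.
rewrite (bigD1 i) //= eqxx scale1r big1 ?addr0 // => j /negbTE ->.
by rewrite scale0r.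
Qed.

(** S indexes the vertices off F. A vector is normal to F when its maximal coordinate is attained at
    every index outside S; its coordinates on the rays are the defects from that maximum. *)
Lemma simplex_normal_cone (l : {linear 'rV[R]_d.+1 -> R^o}) (b : R) :
  let P := standard_simplex R d in
  let F := (P `&` [set x | l x = b])%classic in
  let S := [set j | l (delta_mx 0 j) != b] in
  (F !=set0)%classic -> (forall x, P x -> l x <= b) ->
  proper_sets S /\ normal_cone P F = scone simplex_ray S.
Proof.
move=> P F S F0 lb.
have le_b i : l (delta_mx 0 i) <= b by apply/lb/standard_simplex_vertex.
have supp (a : 'I_d.+1 -> R) : (forall i, 0 <= a i) -> \sum_i a i = 1 ->
    l (\sum_i a i *: delta_mx 0 i) = b -> forall i, i \in S -> a i = 0.
  move=> a0 a1 e i iS.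
  (* The terms are nonnegative, so each vanishes, and the second factor is nonzero for i in S. *)
  have : \sum_i a i * (b - l (delta_mx 0 i)) = 0.
    under eq_bigr do rewrite mulrBr; rewrite sumrB -mulr_suml a1 mul1r -{1}e.
    apply/eqP; rewrite subr_eq0 linear_sum; apply/eqP.
    by apply: eq_bigr => k _; rewrite linearZ.
  move/eqP; rewrite psumr_eq0 => [/allP/(_ i)|k _]; last first.
    by rewrite mulr_ge0 // subr_ge0.
  rewrite mem_index_enum mulf_eq0 subr_eq0 [b == _]eq_sym => /(_ isT).
  by move: iS; rewrite inE => /negbTE ->; rewrite orbF => /eqP.
have [i0 i0S] : exists i, i \notin S.
  have [_ [[a [a0 a1 ->]] e]] := F0.
  apply/existsP; apply: contraT; rewrite negb_exists => /forallP h.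
  have : \sum_i a i = 0.
    by apply: big1 => i _; apply: (supp _ a0 a1 e); rewrite -[_ \in _]negbK.
  by move/eqP; rewrite a1 oner_eq0.
split; first by apply/proper_setsP; exists i0.
have Fvertex i : i \notin S -> F (delta_mx 0 i).
  rewrite inE negbK => /eqP e; split=> //; exact: standard_simplex_vertex.
rewrite predeqE => u; split=> [[w wF <-]|[a [a0 sa ->]]].
  exists (fun j => w 0 i0 - w 0 j); split=> [j|j jS|].
  - have := wF _ _ (Fvertex _ i0S) (standard_simplex_vertex j).
    by rewrite !dot_delta subr_ge0.
  - have := wF _ _ (Fvertex _ i0S) (standard_simplex_vertex j).
    have := wF _ _ (Fvertex _ jS) (standard_simplex_vertex i0).
    by rewrite !dot_delta => h1 h2; apply/eqP; rewrite subr_eq0 eq_le h1 h2.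
  - rewrite sum_simplex_ray; apply/toW_eqP; exists (w 0 i0) => j.
    by rewrite !mxE; ring.
rewrite sum_simplex_ray; exists (\row_j - a j) => // x y [[b1 [b1_0 b1_1 ->]] lx].
case=> b2 [b2_0 b2_1 ->]; rewrite !dot_sum.
have -> : \sum_i b1 i * dot (\row_j - a j) (delta_mx 0 i) = 0.
  apply: big1 => i _; rewrite dot_delta mxE.
  case: (boolP (i \in S)) => [iS|/sa ->]; last by rewrite oppr0 mulr0.
  by rewrite (supp _ b1_0 b1_1 lx i iS) mul0r.
by apply: sumr_le0 => i _; rewrite dot_delta mxE mulrN oppr_le0 mulr_ge0.
Qed.

Lemma simplex_normal_fan :
  normal_fan (standard_simplex R d) = fan_of simplex_ray proper_sets.
Proof.
rewrite predeqE => C; split=> [[F [[F0 [l [b [lb FE]]]] ->]]|[S pS ->]].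
  rewrite FE in F0 *; have [pS ->] := simplex_normal_cone F0 lb.
  by exists [set j | l (delta_mx 0 j) != b].
(* Minus the sum of the coordinates in S is maximal on the simplex, with value 0, on the face whose
   vertices lie outside S. *)
have l_lin : linear (fun x : 'rV[R]_d.+1 => - \sum_(j in S) x 0 j : R^o).
  move=> c x y; rewrite scalerN -opprD scaler_sumr -big_split /=.
  by congr (- _); apply: eq_bigr => j _; rewrite !mxE.
pose l0 := GRing.isLinear.Build R 'rV[R]_d.+1 R^o _ _ l_lin.
pose l : {linear 'rV[R]_d.+1 -> R^o} :=
  HB.pack (fun x : 'rV[R]_d.+1 => - \sum_(j in S) x 0 j : R^o) l0.
have lE x : l x = - \sum_(j in S) x 0 j by [].
have ldelta i : l (delta_mx 0 i) = - (i \in S)%:R.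
  rewrite lE; congr (- _); case: (boolP (i \in S)) => iS.
    rewrite (bigD1 i) //= mxE !eqxx big1 ?addr0 // => j /andP[_ /negbTE ji].
    by rewrite mxE ji andbF.
  rewrite big1 // => j jS; rewrite mxE.
  by case: (j =P i) jS iS => [->->|_ _ _]; rewrite ?andbF.
have lP x : standard_simplex R d x -> l x <= 0.
  case=> a [a0 _ ->]; rewrite linear_sum; apply: sumr_le0 => i _.
  have -> : l (a i *: delta_mx 0 i) = a i * l (delta_mx 0 i) by rewrite linearZ.
  by rewrite ldelta mulrN oppr_le0 mulr_ge0.
have SE : S = [set j | l (delta_mx 0 j) != 0].
  by apply/setP => j; rewrite inE ldelta oppr_eq0; case: (j \in S); rewrite ?oner_eq0 ?eqxx.
pose F := (standard_simplex R d `&` [set x | l x = 0])%classic.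
have F0 : (F !=set0)%classic.
  have [j jS] := proper_setsP _ pS; exists (delta_mx 0 j).
  split; first exact: standard_simplex_vertex.
  by have := ldelta j; rewrite (negbTE jS) oppr0.
exists F; split; first by split=> //; exists l, 0.
by have [_ ->] := simplex_normal_cone F0 lP; rewrite -SE.
Qed.

(** * Gap coordinates on the cones of the two braid fans *)

Definition low (p : 'S_d.+1) (k : 'I_d) : {set 'I_d.+1} := [set i | (p i <= k)%N].

Lemma low_inj p : injective (low p).
Proof.
move=> k l e; apply/val_inj/eqP; rewrite eqn_leq.
have h (m : 'I_d) : (m < d.+1)%N by rewrite ltnS ltnW.
have := congr1 (fun A : {set 'I_d.+1} => p^-1%g (Ordinal (h k)) \in A) e.
have := congr1 (fun A : {set 'I_d.+1} => p^-1%g (Ordinal (h l)) \in A) e.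
by rewrite /= !inE !permKV /= !leqnn => -> <-.
Qed.

(** The representative whose entry in the last place of the order p is 0, with prescribed gaps below
    it. *)
Definition of_gaps p (c : 'I_d -> R) : 'rV[R]_d.+1 :=
  \row_i - \sum_(k < d | (p i <= k)%N) c k.

Lemma sum_low p (c : 'I_d -> R) :
  \sum_k c k *: baryv simplex_ray (low p k) = toW (of_gaps p c).
Proof.
rewrite -[RHS]/(toW (\row_i - \sum_(k < d | (p i <= k)%N) c k)) -sum_simplex_ray.
rewrite /baryv; under eq_bigr do rewrite scaler_sumr big_mkcond.
rewrite exchange_big; apply: eq_bigr => i _; rewrite scaler_suml [RHS]big_mkcond.
by apply: eq_bigr => k _; rewrite inE.
Qed.

Lemma Delta_of_gaps p c : Delta p (of_gaps p c) =1 c.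
Proof.
move=> k; rewrite /Delta !mxE !permKV /= opprK [X in _ + X](bigD1 k) //=.
(* The sums over indices from k and from k + 1 on differ by the term at k. *)
rewrite [X in - X](eq_bigl (fun l : 'I_d => (k <= l)%N && (l != k))).
  by rewrite addrCA addNr addr0.
by move=> l; rewrite /bump /= add1n ltn_neqAle andbC eq_sym.
Qed.

Lemma Delta_inj p x y : Delta p x =1 Delta p y -> toW x = toW y.
Proof.
move=> e; apply/toW_eqP.
(* Equal gaps make the difference of x and y constant along the order p; [inord] allows induction on
   the place. *)
pose z m := x 0 (p^-1%g (inord m)) - y 0 (p^-1%g (inord m)).
exists (z 0%N) => i; rewrite -[i](permK p).
have : (p i < d.+1)%N by [].
have -> : x 0 (p^-1%g (p i)) - y 0 (p^-1%g (p i)) = z (p i) by rewrite /z inord_val.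
elim: (nat_of_ord (p i)) => // m IH md; rewrite -IH; last exact: ltnW.
have := e (Ordinal (md : (m < d)%N)); rewrite /Delta /z.
have -> : lift ord0 (Ordinal (md : (m < d)%N)) = inord m.+1.
  by apply: val_inj; rewrite /= inordK.
have -> : widen_ord (leqnSn d) (Ordinal (md : (m < d)%N)) = inord m.
  by apply: val_inj; rewrite /= inordK // ltnW.
lra.
Qed.

Lemma of_gapsK p x : toW (of_gaps p (Delta p x)) = toW x.
Proof. by apply: (@Delta_inj p); apply: Delta_of_gaps. Qed.

Definition sorted_by p x :=
  forall i j : 'I_d.+1, (i <= j)%N -> x 0 (p^-1%g i) <= x 0 (p^-1%g j).

Lemma Delta_ge0 p x : sorted_by p x -> forall k, 0 <= Delta p x k.
Proof. by move=> s k; rewrite subr_ge0; apply: s; rewrite /= leqnSn. Qed.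

Lemma of_gaps_sorted p c : (forall k, 0 <= c k) -> sorted_by p (of_gaps p c).
Proof.
move=> c0 i j ij; rewrite !mxE !permKV lerN2 big_mkcond [leRHS]big_mkcond /=.
apply: ler_sum => k _; case: (leqP j k) => [jk|_]; last by case: ifP.
by rewrite (leq_trans ij jk).
Qed.

Definition low_gen p (k : 'I_d) : W R d := baryv simplex_ray (low p k).

Lemma braid_coneE p : braid_cone p = cone (low_gen p).
Proof.
rewrite predeqE => w; split=> [[x xs <-]|[c [c0 ->]]].
  exists (Delta p x); split; first exact: Delta_ge0.
  by rewrite sum_low of_gapsK.
by rewrite sum_low; exists (of_gaps p c) => //; apply: of_gaps_sorted.
Qed.

Lemma nested_braid_coneE p t :
  nested_braid_cone p t = scone (baryv (low_gen p)) (upsets t).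
Proof.
rewrite -sorted_scone predeqE => w; split=> [[x [xs xt] <-]|[c [c0 ct ->]]].
  exists (Delta p x); split; [exact: Delta_ge0|exact: xt|].
  by rewrite sum_low of_gapsK.
rewrite sum_low; exists (of_gaps p c) => //; split; first exact: of_gaps_sorted.
by move=> i j ij; rewrite !Delta_of_gaps; apply: ct.
Qed.

(** * Maximal cones as maximal chains, and the two fans *)

Definition low_sets p : {set {set 'I_d.+1}} := low p @: [set: 'I_d].

Lemma braid_cone_scone p : braid_cone p = scone (baryv simplex_ray) (low_sets p).
Proof. by rewrite braid_coneE cone_scone scone_imset //; apply: low_inj. Qed.

(** The flag of subsets of [low_sets p] obtained by adding the gaps one at a time, from the last
    place of t downwards. *)
Definition low_flags p (t : 'S_d) : {set {set {set 'I_d.+1}}} :=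
  [set low p @: (B : {set 'I_d}) | B in upsets t].

Lemma imset_low_inj p : injective (fun B : {set 'I_d} => low p @: B).
Proof. by move=> A B; apply: imset_inj; apply: low_inj. Qed.

Lemma nested_braid_cone_scone p t :
  nested_braid_cone p t = scone (baryv (baryv simplex_ray)) (low_flags p t).
Proof.
rewrite nested_braid_coneE scone_imset; last exact: imset_low_inj.
congr scone; apply/funext => B /=; rewrite /baryv big_imset //.
by move=> k l _ _; apply: low_inj.
Qed.

Lemma low_setsK p : baryK proper_sets (low_sets p).
Proof.
apply/baryKP; split=> [|A /imsetP[k _ ->]].
  apply/is_chainP => A B /imsetP[k _ ->] /imsetP[l _ ->].
  case/orP: (leq_total k l) => kl; apply/orP; [left|right];
    by apply/fintype.subsetP => i; rewrite !inE => /leq_trans; apply.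
split; last by apply/set0Pn; exists (p^-1%g ord0); rewrite inE permKV.
by apply/proper_setsP; exists (p^-1%g ord_max); rewrite inE permKV /= -ltnNge.
Qed.

(** In the order from [chain_perm] each member is an initial segment ending at its last element;
    being proper, it ends before place d. *)
Lemma low_sets_cover SS : baryK proper_sets SS -> exists p, SS \subset low_sets p.
Proof.
case/baryKP=> c h; have [p hp] := chain_perm c; exists p.
apply/fintype.subsetP => A AS; have [/proper_setsP[j0 j0A] /set0Pn[i0 i0A]] := h _ AS.
have [i /= iA mx] := arg_maxnP (fun i => nat_of_ord (p i)) i0A.
have id : (p i < d)%N.
  have := hp _ _ _ AS iA j0A; have := ltn_ord (p j0); lia.
apply/imsetP; exists (Ordinal id) => //; apply/setP => j; rewrite inE /=.
apply/idP/idP => [/mx //|]; rewrite leqNgt; apply: contraR => jA.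
exact: (hp _ _ _ AS iA jA).
Qed.

Lemma low_flagsK p t : baryK (baryK proper_sets) (low_flags p t).
Proof.
apply/baryKP; split=> [|A /imsetP[B /upsetsP[B0 _] ->]].
  apply/is_chainP => A B /imsetP[C hC ->] /imsetP[D hD ->].
  have /is_chainP/(_ _ _ hC hD)/orP[s|s] := upsets_chain t.
    by rewrite imsetS.
  by rewrite (imsetS _ s) orbT.
split; first by apply: (baryK_face _ (low_setsK p)); rewrite imsetS // finset.subsetT.
by have /set0Pn[k kB] := B0; apply/set0Pn; exists (low p k); rewrite imset_f.
Qed.

(** All members of [SS] lie in one chain, hence in some [low_sets p]; pulled back along [low p] they
    form a chain in ['I_d], which a second permutation sorts. *)
Lemma low_flags_cover SS : baryK (baryK proper_sets) SS ->
  exists p t, SS \subset low_flags p t.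
Proof.
move=> KSS; have [S KS SSS] := baryK_cover (subdivision_system simplex_system) KSS.
have [c h] := baryKP _ _ KSS.
have [p /fintype.subsetP Sp] := low_sets_cover KS.
have AE A : A \in SS -> A = low p @: (low p @^-1: A).
  move=> AS; apply/setP => B; apply/idP/imsetP => [BA|[k]]; last by rewrite inE => kA ->.
  have /imsetP[k _ Bk] := Sp _ (fintype.subsetP (SSS _ AS) _ BA).
  by exists k; rewrite // inE -Bk.
(* Complements are sorted because [chain_perm] produces initial segments while [upsets] are final
   ones. *)
have cT : is_chain [set ~: (low p @^-1: (A : {set {set 'I_d.+1}})) | A in SS].
  apply/is_chainP => _ _ /imsetP[A AS ->] /imsetP[B BS ->].
  rewrite !setCS orbC; case/orP: (is_chainP _ c _ _ AS BS) => s.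
    by rewrite (preimsetS _ s).
  by rewrite (preimsetS _ s) orbT.
have [t ht] := chain_perm cT; exists p, t.
apply/fintype.subsetP => A AS; apply/imsetP; exists (low p @^-1: A); last exact: AE.
apply/upsetsP; split=> [|k l kl kA].
  have [_] := h _ AS; apply: contraNneq => e; by rewrite (AE _ AS) e imset0.
rewrite leqNgt in kl; apply: contraR kl => lA.
apply: (ht (~: (low p @^-1: A))); first exact: imset_f.
  by rewrite inE.
by rewrite inE negbK.
Qed.

(** Faces of a maximal cone are spanned by subsets of [low_sets p], and [low_sets_cover] shows that
    every chain arises so. *)
Lemma braid_fanE :
  braid_fan R d = fan_of (baryv simplex_ray) (baryK proper_sets).
Proof.
have sys := subdivision_system simplex_system.
rewrite predeqE => C; split=> [[p]|[SS KSS ->]].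
  rewrite braid_cone_scone => /face_scone_sub[SS sub ->]; exists SS => //.
  exact: face_closed sys _ _ sub (low_setsK p).
have [p sub] := low_sets_cover KSS; exists p; rewrite braid_cone_scone.
by apply/(face_sconeP sys _ (low_setsK p)); exists SS.
Qed.

Lemma nested_braid_fanE : nested_braid_fan R d
  = fan_of (baryv (baryv simplex_ray)) (baryK (baryK proper_sets)).
Proof.
have sys := subdivision_system (subdivision_system simplex_system).
rewrite predeqE => C; split=> [[p [t]]|[SS KSS ->]].
  rewrite nested_braid_cone_scone => /face_scone_sub[SS sub ->]; exists SS => //.
  exact: face_closed sys _ _ sub (low_flagsK p t).
have [p [t sub]] := low_flags_cover KSS; exists p, t.
rewrite nested_braid_cone_scone.
by apply/(face_sconeP sys _ (low_flagsK p t)); exists SS.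
Qed.

End BraidFans.

Theorem theorem5p8 (R : realType) (d : nat) :
  nested_braid_fan R d
    = barycentric_subdivision (latticeW R d) (braid_fan R d) /\
  nested_braid_fan R d
    = barycentric_subdivision (latticeW R d)
        (barycentric_subdivision (latticeW R d)
           (normal_fan (standard_simplex R d))).
Proof.
have sys := simplex_system R d; have sys' := subdivision_system sys.
rewrite simplex_normal_fan (subdivision_fan sys) braid_fanE nested_braid_fanE.
by rewrite (subdivision_fan sys').
Qed.
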